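(* For every integer $n\ge 2$, the following identity of polynomials in $x$ holds: $$(1+2x)^n-2^{n-1}\bigl(\mathcal{B}_n(x+1)-\mathcal{B}(n)\bigr)=\sum_{k=0}^n\binom{n+x-k}{n}D_{n,k},$$ where $\mathcal{B}_n(\cdot)$ is the $n$-th Bernoulli polynomial, $\mathcal{B}(n)$ is the $n$-th Bernoulli number, and $D_{n,k}=|\{\pi\in D_n:\mathrm{des}_D(\pi)=k\}|$ is the Eulerian number of type $D$.
   Context: $B_n$ is the group of signed permutations: bijections $\pi$ of $\{\pm1,\dots,\pm n\}$ with $\pi(-i)=-\pi(i)$ for all $i$. $D_n\subset B_n$ is the subgroup of those $\pi$ for which the number of $i\in\{1,\dots,n\}$ with $\pi(i)<0$ is even. For $\pi\in D_n$ ($n\ge2$), let $\mathrm{Des}_A(\pi)=\{i: 1\le i\le n-1,\ \pi(i)>\pi(i+1)\}$ (usual order on integers). Let $\mathrm{Des}_D(\pi)=\mathrm{Des}_A(\pi)\cup\{0\}$ if $\pi(1)+\pi(2)<0$, and $\mathrm{Des}_D(\pi)=\mathrm{Des}_A(\pi)$ if $\pi(1)+\pi(2)>0$. Put $\mathrm{des}_D(\pi)=|\mathrm{Des}_D(\pi)|$. The binomial $\binom{y}{n}$ denotes the polynomial $y(y-1)\cdots(y-n+1)/n!$. Bernoulli polynomials are given by $\frac{te^{xt}}{e^t-1}=\sum_{n\ge0}\mathcal{B}_n(x)\frac{t^n}{n!}$, and $\mathcal{B}(n)=\mathcal{B}_n(0)$. *)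

(* Defs.v *)
From HB Require Import structures.
From mathcomp Require Import all_boot all_order all_algebra all_fingroup.

Set Implicit Arguments.
Unset Strict Implicit.
Unset Printing Implicit Defensive.

Import Order.TTheory GRing.Theory Num.Theory.
Local Open Scope ring_scope.

(* Formal power series in t with coefficients in Q[x]; [a n] is the
   coefficient of t^n. *)
Definition fps := nat -> {poly rat}.

Definition fps_one : fps := fun n => (n == 0%N)%:R.
Definition fps_t : fps := fun n => (n == 1%N)%:R.
Definition fps_sub (a b : fps) : fps := fun n => a n - b n.
Definition fps_mul (a b : fps) : fps :=
  fun n => \sum_(i < n.+1) a i * b (n - i)%N.

(* exp(c t) *)
Definition fps_exp (c : {poly rat}) : fps := fun n => n`!%:R^-1 *: c ^+ n.

(* a / t, for a without constant term *)
Definition fps_divt (a : fps) : fps := fun n => a n.+1.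

(* [fps_inv_seq a n] lists the first n coefficients of 1 / a, for a 0 a unit. *)
Fixpoint fps_inv_seq (a : fps) (n : nat) : seq {poly rat} :=
  if n is m.+1 then
    let s := fps_inv_seq a m in
    rcons s ((a 0%N)^-1 * ((m == 0%N)%:R - \sum_(i < m) a (m - i)%N * s`_i))
  else [::].
Definition fps_inv (a : fps) : fps := fun n => (fps_inv_seq a n.+1)`_n.

(* t e^(xt) / (e^t - 1), computed as e^(xt) * ((e^t - 1) / t)^-1 because
   e^t - 1 itself is not invertible; see [bernoulli_genfun]. *)
Definition bernoulli_fps : fps :=
  fps_mul (fps_exp 'X) (fps_inv (fps_divt (fps_sub (fps_exp 1) fps_one))).

Definition bernoulli_poly (n : nat) : {poly rat} := n`!%:R *: bernoulli_fps n.
Definition bernoulli_number (n : nat) : rat := (bernoulli_poly n).[0].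

Lemma size_fps_inv_seq a n : size (fps_inv_seq a n) = n.
Proof. by elim: n => //= n IHn; rewrite size_rcons IHn. Qed.

Lemma nth_fps_inv_seq a n i : (i < n)%N -> (fps_inv_seq a n)`_i = fps_inv a i.
Proof.
elim: n => // n IHn; rewrite ltnS leq_eqVlt => /orP[/eqP -> //|lt_in].
by rewrite /= nth_rcons size_fps_inv_seq lt_in IHn.
Qed.

Lemma fps_mulC a b : fps_mul a b =1 fps_mul b a.
Proof.
move=> n; rewrite /fps_mul (reindex_inj rev_ord_inj) /=.
by apply: eq_bigr => i _; rewrite subSS subKn 1?mulrC // -ltnS.
Qed.

Lemma fps_mulE N a b n : (n < N)%N ->
  fps_mul a b n = (\poly_(i < N) a i * \poly_(i < N) b i)`_n.
Proof.
move=> ltnN; rewrite coefM; apply: eq_bigr => i _; rewrite !coef_poly.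
rewrite (leq_ltn_trans (leq_subr _ _) ltnN).
by rewrite (leq_ltn_trans _ ltnN) // -ltnS.
Qed.

Lemma eq_fps_mul a a' b b' : a =1 a' -> b =1 b' -> fps_mul a b =1 fps_mul a' b'.
Proof. by move=> ea eb n; apply: eq_bigr => i _; rewrite ea eb. Qed.

Lemma fps_mulA a b c : fps_mul a (fps_mul b c) =1 fps_mul (fps_mul a b) c.
Proof.
have coefE (d e : fps) N i : (i <= N)%N ->
    (\poly_(j < N.+1) fps_mul d e j)`_i
    = (\poly_(j < N.+1) d j * \poly_(j < N.+1) e j)`_i.
  by move=> le_iN; rewrite coef_poly ltnS le_iN (@fps_mulE N.+1).
move=> n; rewrite !(@fps_mulE n.+1) //.
transitivity ((\poly_(i < n.+1) a i *
    (\poly_(i < n.+1) b i * \poly_(i < n.+1) c i))`_n).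
  by rewrite !coefM; apply: eq_bigr => i _; rewrite coefE // leq_subr.
rewrite mulrA !coefM; apply: eq_bigr => i _; rewrite coefE //.
by rewrite -ltnS.
Qed.

Lemma fps_mul1 a : fps_mul fps_one a =1 a.
Proof.
move=> n; rewrite /fps_mul big_ord_recl subn0 mul1r big1 ?addr0 // => i _.
by rewrite /fps_one lift0 mul0r.
Qed.

Lemma fps_mulV a : a 0%N \is a GRing.unit -> fps_mul a (fps_inv a) =1 fps_one.
Proof.
move=> Ua n; rewrite fps_mulC /fps_mul big_ord_recr /= subnn.
rewrite /fps_inv /= nth_rcons size_fps_inv_seq ltnn eqxx.
rewrite -/(fps_inv _) mulrC mulVKr //.
under eq_bigr => i _ do
  rewrite -[(rcons _ _)`_i]/(fps_inv a i) mulrC -(nth_fps_inv_seq a (ltn_ord i)).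
by rewrite addrC subrK.
Qed.

Lemma fps_divtK a : a 0%N = 0 -> fps_mul fps_t (fps_divt a) =1 a.
Proof.
move=> a0 [|n]; first by rewrite /fps_mul big_ord1 mul0r a0.
rewrite /fps_mul big_ord_recl mul0r add0r big_ord_recl mul1r big1 ?addr0.
  by rewrite /fps_divt lift0 subn1.
by move=> i _; rewrite mul0r.
Qed.

(* (e^t - 1) * \sum_n B_n(x) t^n / n! = t e^(xt) *)
Lemma bernoulli_genfun :
  fps_mul (fps_sub (fps_exp 1) fps_one) (fun n => n`!%:R^-1 *: bernoulli_poly n)
  =1 fps_mul fps_t (fps_exp 'X).
Proof.
set E := fps_sub _ _; have E0 : E 0%N = 0.
  by rewrite /E /fps_sub /fps_exp fact0 invr1 scale1r subrr.
have U : fps_divt E 0%N \is a GRing.unit.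
  by rewrite /fps_divt /E /fps_sub /fps_exp factS fact0 invr1 scale1r subr0 unitr1.
have gE : (fun n => n`!%:R^-1 *: bernoulli_poly n) =1 bernoulli_fps.
  by move=> n; rewrite scalerA mulVf ?scale1r // pnatr_eq0 -lt0n fact_gt0.
move=> n; rewrite (eq_fps_mul (frefl E) gE) /bernoulli_fps -/E.
rewrite -(eq_fps_mul (fps_divtK E0) (frefl _)) -fps_mulA.
apply: eq_fps_mul => // {}n.
rewrite (eq_fps_mul (frefl _) (fps_mulC _ _)) fps_mulA.
by rewrite (eq_fps_mul (fps_mulV U) (frefl _)) fps_mul1.
Qed.

(* y (y - 1) ... (y - n + 1) / n! *)
Definition binomial_poly (y : {poly rat}) (n : nat) : {poly rat} :=
  n`!%:R^-1 *: \prod_(i < n) (y - i%:R).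

(* The set {±1, ..., ±n}: the letter (i, b) stands for i + 1 if b = false and
   for -(i + 1) if b = true. *)
Definition letter (n : nat) : finType := ('I_n * bool)%type.
Definition letter_val (n : nat) (l : letter n) : int :=
  if l.2 then - (l.1.+1)%:Z else (l.1.+1)%:Z.
Definition letter_opp (n : nat) (l : letter n) : letter n := (l.1, ~~ l.2).

Lemma letter_val_inj n : injective (@letter_val n).
Proof.
by move=> [i [|]] [j [|]] //; rewrite /letter_val /= => /eqP;
  rewrite ?eqr_opp => /eqP[/val_inj ->].
Qed.

Lemma letter_val_opp n (l : letter n) :
  letter_val (letter_opp l) = - letter_val l.
Proof. by case: l => i [|]; rewrite /letter_val /= ?opprK. Qed.

Lemma letter_valP n (z : int) :
  (exists l : letter n, letter_val l = z) <-> (0 < `|z| <= n)%N.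
Proof.
split=> [[[i [|]] <-]|]; rewrite ?/letter_val ?abszN ?absz_nat /= ?ltn_ord //.
case: z => m /andP[m_gt0 m_le]; last by exists (Ordinal m_le, true).
by case: m m_gt0 m_le => // m _ m_le; exists (Ordinal m_le, false).
Qed.

Definition signed_perms (n : nat) : {set {perm letter n}} :=
  [set p : {perm letter n} |
     [forall l : letter n, p (letter_opp l) == letter_opp (p l)]].

(* [sp_at p k] is p(k) for 1 <= k <= n, and 0 for any other k. *)
Definition sp_at (n : nat) (p : {perm letter n}) (k : nat) : int :=
  nth 0 (0 :: [seq letter_val (p (i, false)) | i <- enum 'I_n]) k.

Definition even_signed_perms (n : nat) : {set {perm letter n}} :=
  [set p in signed_perms n | ~~ odd #|[set i : 'I_n | sp_at p i.+1 < 0]|].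

(* Descents are elements of 'I_n = {0, ..., n - 1}. *)
Definition DesA (n : nat) (p : {perm letter n}) : {set 'I_n} :=
  [set i : 'I_n | (0 < i)%N && (sp_at p i > sp_at p i.+1)].
Definition DesD (n : nat) (p : {perm letter n}) : {set 'I_n} :=
  if sp_at p 1 + sp_at p 2 < 0
  then DesA p :|: [set i : 'I_n | i == 0%N :> nat]
  else DesA p.
Definition desD (n : nat) (p : {perm letter n}) : nat := #|DesD p|.

Definition eulerianD (n k : nat) : nat :=
  #|[set p in even_signed_perms n | desD p == k]|.

Lemma sp_atE n (p : {perm letter n}) (i : 'I_n) :
  sp_at p i.+1 = letter_val (p (i, false)).
Proof. by rewrite /sp_at /= (nth_map i) ?size_enum_ord // nth_ord_enum. Qed.

(* Main.v *)
(* Stembridge's argument. Write G d for the polynomial binom(n + x - d, n).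
   Flipping the sign of the letter of absolute value 1 preserves des_D and
   swaps D_n with its complement in B_n, so twice the right-hand side is
   \sum_(w in B_n) G (des_D w). Pairing w with the word obtained by flipping
   the sign of its first letter gives
     \sum_(w in B_n) (G (des_D w) + G (1 + r w)) = 2 \sum_(w in B_n) G (des_B w)
   where r w counts the descents among w_2 ... w_n. Inserting the letters +-n
   into the words of B_(n-1) yields Worpitzky identities: the sum on the right
   is (1 + 2x)^n, and P(x) = \sum G (1 + r w) satisfies
   P(x + 1) - P(x) = 2^n n (x + 1)^(n-1) and P(0) = 0, which also characterizes
   2^n (B_n(x + 1) - B_n(0)). *)
Require Import Defs.
From HB Require Import structures.
From mathcomp Require Import all_boot all_order all_algebra all_fingroup.
From mathcomp Require Import ring zify.

Set Implicit Arguments.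
Unset Strict Implicit.
Unset Printing Implicit Defensive.

Import Order.TTheory GRing.Theory Num.Theory.
Local Open Scope ring_scope.

(** * Power series and the difference equation of Bernoulli polynomials *)

Lemma fps_expD (c d : {poly rat}) :
  fps_exp (c + d) =1 fps_mul (fps_exp c) (fps_exp d).
Proof.
move=> n; rewrite /fps_exp /fps_mul addrC exprDn scaler_sumr.
apply: eq_bigr => i _; rewrite -scalerAl -scalerAr !scalerA -scaler_nat scalerA.
have le_in : (i <= n)%N by rewrite -ltnS.
congr (_ *: _); last by rewrite mulrC.
have F k : (k`!%:R : rat) != 0 by rewrite pnatr_eq0 -lt0n fact_gt0.
apply: (mulfI (F n)); rewrite mulrA mulfV // mul1r.
rewrite -(bin_fact le_in) !natrM.
by field; rewrite !F.
Qed.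

Lemma fps_mulBr (a b c : fps) :
  fps_mul a (fps_sub b c) =1 fps_sub (fps_mul a b) (fps_mul a c).
Proof.
by move=> n; rewrite /fps_sub /fps_mul -sumrB; apply: eq_bigr => i _; rewrite mulrBr.
Qed.

Lemma fps_mul_comp (a b : fps) q :
  (fun n => fps_mul a b n \Po q)
  =1 fps_mul (fun n => a n \Po q) (fun n => b n \Po q).
Proof.
by move=> n; rewrite /fps_mul rmorph_sum; apply: eq_bigr => i _; rewrite rmorphM.
Qed.

(** Since a = t + ..., the coefficient of t^(n+1) in ab is b_n plus terms in b_j with j < n, so the
    b_n are recovered one after another. *)
Lemma fps_mulI (a b c : fps) : a 0%N = 0 -> a 1%N = 1 ->
  fps_mul a b =1 fps_mul a c -> b =1 c.
Proof.
move=> a0 a1 eq_abc n; elim/ltn_ind: n => n IHn.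
have := eq_abc n.+1; rewrite /fps_mul !big_ord_recl a0 a1 !mul0r !add0r.
rewrite lift0 subSS subn0 !mul1r => /eqP; rewrite (eq_bigr (fun i : 'I_n =>
  a (lift ord0 (lift ord0 i)) * c (n.+1 - lift ord0 (lift ord0 i))%N)).
  by rewrite (inj_eq (addIr _)) => /eqP.
by move=> i _; rewrite IHn // !lift0; have := ltn_ord i; lia.
Qed.

(** Replacing x by x + 1 multiplies t e^(xt) by e^t. Hence the difference of the two generating
    functions, times e^t - 1, is t e^(xt) (e^t - 1), and e^t - 1 cancels by [fps_mulI]. *)
Lemma bernoulli_poly_diff n : (0 < n)%N ->
  bernoulli_poly n \Po ('X + 1) - bernoulli_poly n = n%:R *: 'X ^+ n.-1.
Proof.
set E := fps_sub (fps_exp 1) fps_one.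
set b : fps := fun n => n`!%:R^-1 *: bernoulli_poly n.
have E0 : E 0%N = 0 by rewrite /E /fps_sub /fps_exp fact0 invr1 scale1r subrr.
have E1 : E 1%N = 1 by rewrite /E /fps_sub /fps_exp invr1 scale1r subr0.
(* The coefficients of [E] and [fps_t] are free of x, so the shift only acts on e^(xt). *)
have EC i : E i \Po ('X + 1) = E i.
  rewrite /E /fps_sub /fps_exp /fps_one linearB linearZ /= expr1n.
  by rewrite comp_polyC -polyC_natr comp_polyC.
have tC i : fps_t i \Po ('X + 1) = fps_t i.
  by rewrite /fps_t -polyC_natr comp_polyC.
have xC i : fps_exp 'X i \Po ('X + 1) = fps_exp ('X + 1) i.
  by rewrite /fps_exp linearZ /= rmorphXn /= comp_polyX.
have key : fps_sub (fun i => b i \Po ('X + 1)) b =1 fps_mul fps_t (fps_exp 'X).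
  apply: (fps_mulI E0 E1) => i; rewrite fps_mulBr /fps_sub.
  rewrite -(eq_fps_mul EC (frefl _)) -fps_mul_comp !bernoulli_genfun.
  rewrite fps_mul_comp (eq_fps_mul tC xC) -/(fps_sub _ _ i) -fps_mulBr.
  rewrite fps_mulA (eq_fps_mul (fps_mulC E fps_t) (frefl _)) -fps_mulA.
  apply: eq_fps_mul => // j; rewrite fps_mulC fps_mulBr /fps_sub.
  by rewrite -fps_expD fps_mulC fps_mul1.
case: n => // n _; have := key n.+1.
rewrite /fps_mul !big_ord_recl mul0r add0r mul1r big1 => [|i _]; last first.
  by rewrite mul0r.
rewrite addr0 lift0 subSS subn0 /fps_sub /b linearZ /= -scalerBr /fps_exp.
have F k : (k`!%:R : rat) != 0 by rewrite pnatr_eq0 -lt0n fact_gt0.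
move/(congr1 (fun p => n.+1`!%:R *: p)); rewrite !scalerA mulfV // scale1r => ->.
by rewrite factS natrM mulfK.
Qed.

(** * Binomial polynomials and periodic polynomials *)

Lemma binomial_poly0 y : binomial_poly y 0 = 1.
Proof. by rewrite /binomial_poly big_ord0 fact0 invr1 scale1r. Qed.

(** This recurrence and the next one turn both binomials of an insertion sum into multiples of a
    single binomial of lower degree. *)
Lemma binomial_poly_recr y n :
  n.+1%:R * binomial_poly y n.+1 = (y - n%:R) * binomial_poly y n.
Proof.
rewrite /binomial_poly big_ord_recr /= mulr_natl -scaler_nat scalerA factS natrM.
by rewrite invfM mulVKf ?pnatr_eq0 // mulrC scalerAr.
Qed.

Lemma binomial_poly_recl y n :
  n.+1%:R * binomial_poly (y + 1) n.+1 = (y + 1) * binomial_poly y n.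
Proof.
rewrite /binomial_poly big_ord_recl /= subr0 mulr_natl -scaler_nat scalerA factS.
rewrite natrM invfM mulVKf ?pnatr_eq0 // scalerAr; congr (_ * (_ *: _)).
by apply: eq_bigr => i _; rewrite -[(bump _ _)]/(i.+1) -natr1; ring.
Qed.

Lemma polyQ_nat_neq0 n : n.+1%:R != 0 :> {poly rat}.
Proof. by rewrite -polyC_natr polyC_eq0 pnatr_eq0. Qed.

Lemma binomial_poly_pascal y n :
  binomial_poly (y + 1) n.+1 = binomial_poly y n.+1 + binomial_poly y n.
Proof.
apply: (mulfI (polyQ_nat_neq0 n)).
by rewrite mulrDr binomial_poly_recl binomial_poly_recr; ring.
Qed.

Lemma binomial_poly_comp y q n :
  binomial_poly y n \Po q = binomial_poly (y \Po q) n.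
Proof.
rewrite /binomial_poly linearZ /= rmorph_prod; congr (_ *: _).
by apply: eq_bigr => i _; rewrite rmorphB /= -polyC_natr comp_polyC.
Qed.

Lemma horner_binomial_nat (c : {poly rat}) k n : (k < n)%N -> c.[0] = k%:R ->
  (binomial_poly c n).[0] = 0.
Proof.
move=> lt_kn c0; rewrite /binomial_poly hornerZ horner_prod.
rewrite (bigD1 (Ordinal lt_kn)) // hornerD hornerN -polyC_natr hornerC c0 subrr.
by rewrite /= mul0r mulr0.
Qed.

(** Periodicity spreads the root 0 to all natural numbers, more roots than the degree allows. *)
Lemma poly_periodic_eq0 (p : {poly rat}) : p \Po ('X + 1) = p -> p.[0] = 0 -> p = 0.
Proof.
move=> p1 p0; have pn n : p.[n%:R] = 0.
  by elim: n => // n IHn; rewrite -IHn -[in RHS]p1 horner_comp !hornerE natr1.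
apply: (@roots_geq_poly_eq0 _ p [seq n%:R | n <- iota 0 (size p)]).
- by apply/allP => _ /mapP[n _ ->]; apply/rootP.
- by rewrite map_inj_uniq ?iota_uniq // => i j /eqP; rewrite eqr_nat => /eqP.
- by rewrite size_map size_iota.
Qed.

(** * Descents under insertion of a letter of largest absolute value *)

(* Descents of the word c :: w; with c = 0 this is the type B statistic. *)
Fixpoint desc (c : int) (w : seq int) : nat :=
  if w is x :: w' then ((x < c)%R + desc x w')%N else 0%N.

Definition des (w : seq int) : nat := if w is x :: w' then desc x w' else 0%N.

Fixpoint ins (x : int) (w : seq int) : seq (seq int) :=
  (x :: w) :: (if w is y :: w' then [seq y :: u | u <- ins x w'] else [::]).

Definition ins_pm (N : nat) (w : seq int) : seq (seq int) :=
  ins N%:Z w ++ ins (- N%:Z) w.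

Definition bounded (N : nat) (w : seq int) : bool :=
  all (fun x : int => `|x|%N < N)%N w.

(* One-line notations of the elements of B_n; see [mem_swords]. *)
Fixpoint swords (n : nat) : seq (seq int) :=
  if n is n'.+1 then [seq u | w <- swords n', u <- ins_pm n'.+1 w] else [:: [::]].

Lemma desc_le_size c w : (desc c w <= size w)%N.
Proof. by elim: w c => //= x w IHw c; rewrite -add1n leq_add ?leq_b1. Qed.

(** Either sign of N keeps the number of descents when inserted into a descent and raises it by one
    when inserted into an ascent. At the end of the word, N keeps it and -N raises it. *)
Lemma sum_ins_desc (N : nat) (c : int) w (F : nat -> {poly rat}) :
  (`|c| < N)%N -> bounded N w ->
  \sum_(u <- ins_pm N w) F (desc c u)
  = (2%:R * (desc c w)%:R + 1) * F (desc c w)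
    + (2%:R * ((size w)%:R - (desc c w)%:R) + 1) * F (desc c w).+1.
Proof.
rewrite big_cat /=; elim: w c F => [|b w IHw] c F cN.
  move=> _; rewrite /= !big_seq1 /=.
  have -> : (N%:Z < c) = false by lia.
  have -> : (- N%:Z < c) by lia.
  by rewrite addn0; ring.
move=> /= /andP[bN wN]; rewrite !big_cons !big_map /=.
have -> : (N%:Z < c) = false by lia.
have -> : (- N%:Z < c) by lia.
have -> : (b < N%:Z) by lia.
have -> : (b < - N%:Z) = false by lia.
(* Words that keep [b] in front share the comparison of [c] with [b], so [F] is shifted by it. *)
rewrite addrACA (IHw b (fun d => F ((b < c)%R + d)%N)) // -[(size w).+1%:R]natr1.
by case: (b < c); rewrite ?add0n ?add1n -?[(desc b w).+1%:R]natr1; ring.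
Qed.

(** Here nothing precedes the word: N placed in front of a nonempty word adds a descent, -N does
    not. The other positions are those of [sum_ins_desc] started at the first letter. *)
Lemma sum_ins_des (N : nat) w (F : nat -> {poly rat}) : bounded N w ->
  \sum_(u <- ins_pm N w) F (des u)
  = 2%:R * ((des w)%:R + 1) * F (des w)
    + 2%:R * ((size w)%:R - (des w)%:R) * F (des w).+1.
Proof.
case: w => [|b w /= /andP[bN wN]].
  by move=> _; rewrite big_cat /= !big_seq1 /=; ring.
have := sum_ins_desc F bN wN; rewrite !big_cat /= !big_cons !big_map /=.
have -> : (b < N%:Z) by lia.
have -> : (b < - N%:Z) = false by lia.
by rewrite addrACA => ->; rewrite -[(size w).+1%:R]natr1 add1n add0n; ring.
Qed.

(* The summands of the Worpitzky identities of type B and type A. *)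
Definition wordB (w : seq int) : {poly rat} :=
  binomial_poly ((size w)%:R + 'X - (desc 0 w)%:R) (size w).

Definition wordA (w : seq int) : {poly rat} :=
  binomial_poly ((size w)%:R + 'X - 1 - (des w)%:R) (size w).

Lemma mem_ins x w u :
  u \in ins x w -> exists w1 w2, w = w1 ++ w2 /\ u = w1 ++ x :: w2.
Proof.
elim: w u => [|y w IHw] u /=; rewrite in_cons => /orP[/eqP->|//].
- by exists [::], [::].
- by exists [::], (y :: w).
- move=> /mapP[v /IHw[w1 [w2 [-> ->]]] ->].
  by exists (y :: w1), w2.
Qed.

Lemma ins_cat x w1 w2 : w1 ++ x :: w2 \in ins x (w1 ++ w2).
Proof.
elim: w1 => [|y w1 IHw]; first by case: w2 => [|? ?]; exact: mem_head.
by rewrite /= inE map_f ?orbT.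
Qed.

Lemma size_ins x w u : u \in ins x w -> size u = (size w).+1.
Proof. by move=> /mem_ins[w1 [w2 [-> ->]]]; rewrite !size_cat /= addnS. Qed.

Lemma size_ins_pm N w u : u \in ins_pm N w -> size u = (size w).+1.
Proof. by rewrite mem_cat => /orP[] /size_ins. Qed.

(** With y = k + x - d, everything reduces to (2d + 1)(y + 1) + (2(k - d) + 1)(y - k) = (k + 1)(1 +
    2x). *)
Lemma sum_ins_wordB N w : (0 < N)%N -> bounded N w ->
  \sum_(u <- ins_pm N w) wordB u = (1 + 2%:R * 'X) * wordB w.
Proof.
move=> N0 wN; set k := size w.
rewrite big_seq_cond (eq_bigr (fun u =>
  binomial_poly (k.+1%:R + 'X - (desc 0 u)%:R) k.+1)); last first.
  by move=> u /andP[/size_ins_pm uk _]; rewrite /wordB uk.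
rewrite -big_seq_cond (sum_ins_desc
  (fun d => binomial_poly (k.+1%:R + 'X - d%:R) k.+1)) // -/k.
apply: (mulfI (polyQ_nat_neq0 k)); rewrite /wordB -/k.
set d := desc 0 w; set y := k%:R + 'X - d%:R.
have -> : k.+1%:R + 'X - d%:R = y + 1 by rewrite /y -natr1; ring.
have -> : k.+1%:R + 'X - d.+1%:R = y by rewrite /y -!natr1; ring.
rewrite mulrDr 2![k.+1%:R * (_ * _)]mulrCA binomial_poly_recl binomial_poly_recr.
by rewrite /y -natr1; ring.
Qed.

(** With y = k + x - 1 - d, everything reduces to 2(d + 1)(y + 1) + 2(k - d)(y - k) = 2(k + 1)x. *)
Lemma sum_ins_wordA N w : bounded N w ->
  \sum_(u <- ins_pm N w) wordA u = 2%:R * 'X * wordA w.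
Proof.
move=> wN; set k := size w.
rewrite big_seq_cond (eq_bigr (fun u =>
  binomial_poly (k.+1%:R + 'X - 1 - (des u)%:R) k.+1)); last first.
  by move=> u /andP[/size_ins_pm uk _]; rewrite /wordA uk.
rewrite -big_seq_cond (sum_ins_des
  (fun d => binomial_poly (k.+1%:R + 'X - 1 - d%:R) k.+1)) // -/k.
apply: (mulfI (polyQ_nat_neq0 k)); rewrite /wordA -/k.
set d := des w; set y := k%:R + 'X - 1 - d%:R.
have -> : k.+1%:R + 'X - 1 - d%:R = y + 1 by rewrite /y -natr1; ring.
have -> : k.+1%:R + 'X - 1 - d.+1%:R = y by rewrite /y -!natr1; ring.
rewrite mulrDr 2![k.+1%:R * (_ * _)]mulrCA binomial_poly_recl binomial_poly_recr.
by rewrite /y -natr1; ring.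
Qed.

(** * The words built by insertion, each obtained exactly once *)

Definition absw (w : seq int) : seq nat := [seq `|x|%N | x <- w].

(** In the inductive step, the letter of absolute value n + 1 is the one inserted last; deleting it
    leaves a word of the previous stage. *)
Lemma mem_swords n w : (w \in swords n) = perm_eq (absw w) (iota 1 n).
Proof.
have iotaS m : perm_eq (iota 1 m.+1) (m.+1 :: iota 1 m).
  by rewrite -{1}[m.+1]addn1 iotaD add1n /= cats1 perm_rcons.
elim: n w => [|n IHn] w /=.
  by rewrite inE; case: w => // x w; apply/esym/negbTE/negP => /perm_size.
apply/allpairsPdep/idP => [[v [u [vn uv ->]]]|].
  have {uv} [x [xn /mem_ins[w1 [w2 [ev ->]]]]] : exists x : int,
      `|x|%N = n.+1 /\ u \in ins x v.
    by move: uv; rewrite mem_cat => /orP[]; [exists n.+1%:Z | exists (- n.+1%:Z)];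
      split => //; rewrite abszN.
  rewrite (permPr (iotaS n)) /absw map_cat /= perm_catC /= xn.
  by rewrite perm_cons perm_catC -map_cat -ev -/(absw v) -IHn.
move=> wn; have : n.+1 \in absw w.
  by rewrite (perm_mem wn) (perm_mem (iotaS n)) mem_head.
case/mapP => x /splitPr ew xn; case: ew wn => w1 w2 wn.
exists (w1 ++ w2), (w1 ++ x :: w2); split => //.
  rewrite IHn; move: wn; rewrite (permPr (iotaS n)) /absw map_cat /= perm_catC /=.
  by rewrite -xn perm_cons perm_catC -map_cat.
rewrite mem_cat; case: x xn {wn} => m /= xn; rewrite xn.
  by rewrite ins_cat.
have -> : Negz m = - (m.+1)%:Z by [].
by rewrite ins_cat orbT.
Qed.

Lemma swords_bounded n w : w \in swords n -> bounded n.+1 w.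
Proof.
rewrite mem_swords => wn; apply/allP => x xw.
have : `|x|%N \in absw w by apply: map_f.
by rewrite (perm_mem wn) mem_iota; lia.
Qed.

Lemma size_swords n w : w \in swords n -> size w = n.
Proof. by rewrite mem_swords => /perm_size; rewrite size_map size_iota. Qed.

Lemma uniq_ins x w : x \notin w -> uniq (ins x w).
Proof.
elim: w => //= y w IHw; rewrite inE negb_or => /andP[xy xw].
rewrite map_inj_uniq ?IHw // => [|u v [] //].
by rewrite andbT; apply/mapP => -[u _ [/eqP]]; rewrite (negbTE xy).
Qed.

Lemma uniq_ins_pm N w : (0 < N)%N -> bounded N w -> uniq (ins_pm N w).
Proof.
move=> N0 /allP wN; rewrite cat_uniq !uniq_ins ?andbT //=; last 2 first.
- by apply/negP => /wN /=; lia.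
- by apply/negP => /wN /=; lia.
apply/hasPn => u /mem_ins[w1 [w2 [ew eu]]]; apply/negP => /mem_ins[v1 [v2 [ew' eu']]].
have : N%:Z \in u by rewrite eu' mem_cat inE eqxx orbT.
rewrite eu mem_cat inE => H.
have : N%:Z \in w by move: H; rewrite ew mem_cat => /or3P[->|/eqP|->]; rewrite ?orbT //; lia.
by move=> /wN /=; lia.
Qed.

(** Deleting the inserted letter undoes the insertion, so different words never produce a common
    one. *)
Lemma ins_pm_inj N w u : bounded N w -> u \in ins_pm N w ->
  w = [seq x : int <- u | (`|x| < N)%N].
Proof.
move=> /all_filterP wN; rewrite mem_cat => /orP[] /mem_ins[w1 [w2 [ew ->]]];
  rewrite filter_cat /= ?abszN ?ltnn -filter_cat -ew;
  by rewrite wN.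
Qed.

Lemma uniq_swords n : uniq (swords n).
Proof.
elim: n => //= n IHn; apply: allpairs_uniq_dep => //.
  by move=> w /swords_bounded wn; apply: uniq_ins_pm.
move=> [w u] [w' u'] /allpairsPdep[x [y [/swords_bounded xn yx [-> ->]]]].
move=> /allpairsPdep[x' [y' [/swords_bounded xn' yx' [-> ->]]]] /= eyy'.
by rewrite (ins_pm_inj xn yx) (ins_pm_inj xn' yx') eyy'.
Qed.

(** * Worpitzky identities of types B and A *)

Lemma sum_swordsS (V : nmodType) n (F : seq int -> V) :
  \sum_(w <- swords n.+1) F w
  = \sum_(w <- swords n) \sum_(u <- ins_pm n.+1 w) F u.
Proof. by rewrite /= big_allpairs_dep. Qed.

Lemma sum_wordB n : \sum_(w <- swords n) wordB w = (1 + 2%:R * 'X) ^+ n.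
Proof.
elim: n => [|n IHn]; first by rewrite big_seq1 /wordB /= binomial_poly0.
rewrite sum_swordsS exprS -IHn mulr_sumr; apply: eq_big_seq => w wn.
by rewrite sum_ins_wordB // swords_bounded.
Qed.

Lemma sum_wordA n : \sum_(w <- swords n) wordA w = (2%:R * 'X) ^+ n.
Proof.
elim: n => [|n IHn]; first by rewrite big_seq1 /wordA /= binomial_poly0.
rewrite sum_swordsS exprS -IHn mulr_sumr; apply: eq_big_seq => w wn.
by rewrite sum_ins_wordA // swords_bounded.
Qed.

(** Inserting the new letter in front, with either sign, makes the whole old word the tail;
    inserting it later is an insertion into the old tail. The first case contributes [sum_wordA],
    the second the induction hypothesis times 2x. *)
Lemma sum_behead_wordA n :
  \sum_(w <- swords n.+1) wordA (behead w) = 2%:R * n.+1%:R * (2%:R * 'X) ^+ n.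
Proof.
elim: n => [|n IHn].
  rewrite sum_swordsS big_seq1 big_cat /= !big_seq1 /wordA /= binomial_poly0.
  by ring.
rewrite sum_swordsS -[n.+2%:R]natr1.
transitivity (\sum_(w <- swords n.+1) (2%:R * wordA w + 2%:R * 'X * wordA (behead w))).
  apply: eq_big_seq => w wn; have := swords_bounded wn.
  case: w wn => [/size_swords //|a w] wn /= /andP[_ wb].
  rewrite -(sum_ins_wordA wb) !big_cat /= !big_cons !big_map /=.
  by rewrite addrACA -mulr2n mulr_natl.
by rewrite big_split -!mulr_sumr IHn sum_wordA !exprS /=; ring.
Qed.

(** * One-line notation as a bijection from signed permutations to words *)

Definition word (n : nat) (p : {perm letter n}) : seq int :=
  [seq letter_val (p (i, false)) | i <- enum 'I_n].

Lemma nth_word n (p : {perm letter n}) (i : 'I_n) :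
  nth 0 (word p) i = letter_val (p (i, false)).
Proof. by rewrite /word (nth_map i) ?size_enum_ord // nth_ord_enum. Qed.

Lemma size_word n (p : {perm letter n}) : size (word p) = n.
Proof. by rewrite size_map size_enum_ord. Qed.

Lemma signed_permE n (p : {perm letter n}) i b : p \in signed_perms n ->
  p (i, b) = if b then letter_opp (p (i, false)) else p (i, false).
Proof. by rewrite inE => /forallP/(_ (i, false))/eqP; case: b. Qed.

Lemma word_inj n : {in signed_perms n &, injective (@word n)}.
Proof.
move=> p q sp sq epq; apply/permP => -[i b].
have e : p (i, false) = q (i, false).
  by apply: (@letter_val_inj n); rewrite -!nth_word epq.
by rewrite (signed_permE i b sp) (signed_permE i b sq) e.
Qed.

Lemma absz_letter_val n (l : letter n) : `|letter_val l|%N = l.1.+1.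
Proof. by case: l => i []; rewrite /letter_val /= ?abszN. Qed.

Lemma perm_eq_iota n (s : seq nat) : size s = n -> uniq s ->
  all (fun k => 0 < k <= n)%N s -> perm_eq s (iota 1 n).
Proof.
move=> sn us /allP sb; apply: uniq_perm; rewrite ?iota_uniq //.
have sub : {subset s <= iota 1 n}.
  by move=> k /sb; rewrite mem_iota add1n ltnS.
by have [] := uniq_min_size us sub _; rewrite ?size_iota ?sn.
Qed.

Lemma word_swords n (p : {perm letter n}) :
  p \in signed_perms n -> word p \in swords n.
Proof.
move=> sp; rewrite mem_swords; apply: perm_eq_iota.
- by rewrite size_map size_word.
- rewrite /absw /word -map_comp map_inj_uniq ?enum_uniq // => i j /=.
  rewrite !absz_letter_val => -[/val_inj eij].
  have := signed_permE j true sp; rewrite /letter_opp.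
  case ei: (p (i, false)) eij => [k b]; case ej: (p (j, false)) => [l c] /= ekl ej'.
  rewrite {}ekl in ei.
  (* Equal absolute values mean p(i) = p(j) or p(i) = -p(j) = p(-j); injectivity gives i = j in the
     first case and excludes the second. *)
  have [ebc|nbc] := eqVneq b c.
    by have /perm_inj[] : p (i, false) = p (j, false) by rewrite ei ej ebc.
  suff /perm_inj[] : p (i, false) = p (j, true) by [].
  by rewrite ei ej'; congr (_, _); case: (b) (c) nbc => [] [].
- by apply/allP => _ /mapP[_ /mapP[i _ ->] ->]; rewrite absz_letter_val /= ltn_ord.
Qed.

(** Send each i to the letter of value w_i and extend oddly. This is injective because the absolute
    values in w are distinct and no letter is its own opposite. *)
Lemma swords_word n (w : seq int) : w \in swords n ->
  exists2 p : {perm letter n}, p \in signed_perms n & w = word p.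
Proof.
rewrite mem_swords => wn; have sw : size w = n.
  by have := perm_size wn; rewrite size_map size_iota.
have uw : uniq (absw w) by rewrite (perm_uniq wn) iota_uniq.
have ex (i : 'I_n) : exists l : letter n, letter_val l == nth 0 w i.
  have [|l <-] := (letter_valP n (nth 0%R w i)).2; last by exists l.
  have : `|nth 0%R w i|%N \in absw w by rewrite map_f // mem_nth // sw.
  by rewrite (perm_mem wn) mem_iota add1n ltnS.
pose g (i : 'I_n) := xchoose (ex i).
have gE i : letter_val (g i) = nth 0 w i by apply/eqP/(xchooseP (ex i)).
pose h (l : letter n) := if l.2 then letter_opp (g l.1) else g l.1.
have gI i j : (g i).1 = (g j).1 -> i = j.
  move=> eij; apply/val_inj/eqP; rewrite -[_ == _]/(i == j :> nat).
  rewrite -(nth_uniq 0%N _ _ uw) ?size_map ?sw ?ltn_ord //.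
  by rewrite /absw !(nth_map (0 : int)) ?sw ?ltn_ord // -!gE !absz_letter_val eij.
have hI : injective h.
  move=> [i b] [j c] e; have eij : i = j.
    by apply: gI; move: (congr1 fst e); rewrite /h /=; case: (b); case: (c).
  move: e; rewrite eij /h /=; case: (g j) => k d.
  by case: b; case: c => // -[]; case: d.
exists (perm hI).
  by rewrite inE; apply/forallP => -[i []]; rewrite !permE /h /letter_opp //=;
     case: (g i) => k d; rewrite negbK.
apply: (@eq_from_nth _ 0); rewrite ?size_word ?sw // => i ltin.
by rewrite -[i]/(val (Ordinal ltin)) nth_word permE /h /= gE.
Qed.

Lemma sum_signed_perms (V : nmodType) n (F : seq int -> V) :
  \sum_(p in signed_perms n) F (word p) = \sum_(w <- swords n) F w.
Proof.
rewrite -big_enum -(big_map (@word n) xpredT F); apply: perm_big.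
apply: uniq_perm; rewrite ?uniq_swords //.
  rewrite map_inj_in_uniq ?enum_uniq // => p q.
  by rewrite !mem_enum; apply: word_inj.
move=> w; apply/mapP/idP => [[p]|/swords_word[p sp ->]].
  by rewrite mem_enum => sp ->; apply: word_swords.
by exists p; rewrite ?mem_enum.
Qed.

(** * Descent statistics read off the word *)

Lemma descE c w :
  desc c w = (\sum_(i < size w) (nth 0 w i < nth 0 (c :: w) i)%R)%N.
Proof. by elim: w c => [|x w IHw] c; rewrite /= ?big_ord0 // big_ord_recl IHw. Qed.

Lemma sp_at_word n (p : {perm letter n}) k : sp_at p k = nth 0 (0 :: word p) k.
Proof. by []. Qed.

Lemma card_DesA n (p : {perm letter n}) : #|DesA p| = des (word p).
Proof.
rewrite -sum1_card big_mkcond /=.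
transitivity (\sum_(i < n) ((0 < i)%N && (sp_at p i.+1 < sp_at p i))%R)%N.
  by apply: eq_bigr => i _; rewrite inE; case: (_ && _).
under eq_bigr do rewrite !sp_at_word.
have := size_word p; case: (word p) => [|x w] /= <-; first by rewrite big_ord0.
by rewrite descE big_ord_recl.
Qed.

Definition desDw (w : seq int) : nat :=
  ((nth 0 w 0 + nth 0 w 1 < 0)%R + des w)%N.

Lemma desD_word n (p : {perm letter n}) : (0 < n)%N -> desD p = desDw (word p).
Proof.
case: n p => // n p _; rewrite /desD /DesD !sp_at_word /= /desDw -card_DesA.
case: ifP => // _; have -> : [set i : 'I_n.+1 | i == 0%N :> nat] = [set ord0].
  by apply/setP => i; rewrite !inE.
by rewrite setUC cardsU1 inE.
Qed.

(** * The two sign-flipping involutions *)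

Lemma sum_swords_sym (V : nmodType) n (f : seq int -> seq int) (F : seq int -> V) :
  involutive f -> (forall w, absw (f w) = absw w) ->
  \sum_(w <- swords n) F (f w) = \sum_(w <- swords n) F w.
Proof.
move=> fK fa; rewrite -(big_map f xpredT F); apply/perm_big/uniq_perm.
- by rewrite (map_inj_uniq (inv_inj fK)) uniq_swords.
- exact: uniq_swords.
move=> w; apply/mapP/idP => [[v vn ->]|wn]; first by rewrite mem_swords fa -mem_swords.
by exists (f w); rewrite ?fK // mem_swords fa -mem_swords.
Qed.

Definition opp_head (w : seq int) : seq int :=
  if w is x :: w' then - x :: w' else [::].

(** Doubling both sides allows each word to be paired with its image under [opp_head]; the identity
    then holds pair by pair. *)
Lemma sum_desD_desB n (G : nat -> {poly rat}) : (1 < n)%N ->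
  \sum_(w <- swords n) (G (desDw w) + G (des (behead w)).+1)
  = 2%:R * \sum_(w <- swords n) G (desc 0 w).
Proof.
move=> n1; have hK : involutive opp_head by case=> //= x w; rewrite opprK.
have ha w : absw (opp_head w) = absw w by case: w => //= x w; rewrite abszN.
apply: (mulfI (polyQ_nat_neq0 1)).
rewrite [LHS]mulrDl !mul1r -[X in _ + X](sum_swords_sym _ _ hK ha) -big_split /=.
rewrite mulrCA [X in _ = _ * X]mulrDl mul1r.
rewrite -[X in _ = _ * (_ + X)](sum_swords_sym _ _ hK ha) -big_split /= mulr_sumr.
apply: eq_big_seq => w wn.
have := size_swords wn; case: w wn => [|a [|b w]] wn /= sw; try by rewrite -sw in n1.
have : uniq (absw [:: a, b & w]).
  by move: wn; rewrite mem_swords => /perm_uniq ->; rewrite iota_uniq.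
rewrite /= inE negb_or -andbA => /and3P[ab _ _].
have a0 : a != 0 /\ b != 0.
  have : 0%N \notin absw [:: a, b & w].
    by move: wn; rewrite mem_swords => /perm_mem ->; rewrite mem_iota.
  by rewrite !inE; lia.
rewrite /desDw /=; set r := desc b w.
have e0 : (a < 0) = ~~ (- a < 0) by lia.
(* If |a| < |b|, put e = 1 when b < 0 and e = 0 otherwise: des_D is r + 2e for both signs of a,
   while des_B takes the values r + e and r + e + 1. *)
have [lab|lab] := ltnP `|a|%N `|b|%N.
  have -> : (- a + b < 0) = (a + b < 0) by lia.
  have -> : (b < - a) = (b < a) by lia.
  have -> : (a + b < 0) = (b < a) by lia.
  by rewrite e0; case: (- a < 0); case: (b < a); rewrite /= ?add0n ?add1n; ring.
(* If |a| > |b|, both statistics equal r + 1 for both signs of a. *)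
have -> : (a + b < 0) = (a < 0) by lia.
have -> : (- a + b < 0) = (- a < 0) by lia.
have -> : (b < - a) = (a < 0) by lia.
have -> : (b < a) = ~~ (a < 0) by lia.
by rewrite e0; case: (- a < 0); rewrite /= ?add0n ?add1n; ring.
Qed.

Definition flip_one (x : int) : int := if `|x|%N == 1%N then - x else x.

Definition negs (w : seq int) : nat := count (fun x : int => x < 0) w.

Lemma flip_oneK : involutive flip_one.
Proof. by move=> x; rewrite /flip_one; do 2?case: ifP => //; lia. Qed.

Lemma absz_flip_one x : `|flip_one x|%N = `|x|%N.
Proof. by rewrite /flip_one; case: ifP => //; rewrite abszN. Qed.

Lemma odd_negs_flip_one w :
  odd (negs (map flip_one w)) = odd (negs w) (+) odd (count_mem 1%N (absw w)).
Proof.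
rewrite /negs; elim: w => //= x w IHw; rewrite !oddD IHw.
rewrite [RHS]addbACA; congr (_ (+) _).
by rewrite /flip_one; case: eqP => /= x1; rewrite !oddb ?addbF // addbT; lia.
Qed.

(** If one letter is 1 or -1, the other has absolute value at least 2, and its sign alone decides
    the comparison. *)
Lemma ltr_flip_one x y : x != 0 -> `|x|%N != `|y|%N -> y != 0 ->
  (flip_one x < flip_one y) = (x < y).
Proof.
move=> x0 xy y0; rewrite /flip_one.
by case: ifP => hx; case: ifP => hy; apply/idP/idP; lia.
Qed.

Lemma desc_flip_one c w : 0%N \notin absw (c :: w) -> uniq (absw (c :: w)) ->
  desc (flip_one c) (map flip_one w) = desc c w.
Proof.
elim: w c => //= x w IHw c; rewrite inE negb_or => /andP[c0 xw0].
rewrite inE negb_or -andbA => /and3P[cx _ xw].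
have x0 : x != 0 by move: xw0; rewrite inE; lia.
by rewrite IHw // ltr_flip_one // 1?eq_sym //; lia.
Qed.

Lemma desDw_flip_one n w : (1 < n)%N -> w \in swords n ->
  desDw (map flip_one w) = desDw w.
Proof.
move=> n1 wn; have sw := size_swords wn; move: wn; rewrite mem_swords => wn.
have w0 : 0%N \notin absw w by rewrite (perm_mem wn) mem_iota.
have uw : uniq (absw w) by rewrite (perm_uniq wn) iota_uniq.
case: w sw w0 uw {wn} => [|a [|b w]] sw w0 uw; try by rewrite -sw in n1.
have := desc_flip_one w0 uw; rewrite /desDw /= => ->; congr (_ + _)%N.
move: w0 uw; rewrite /= !inE !negb_or => /and3P[a0 b0 _] /andP[/andP[ab _] _].
(* The sign of a + b is that of the letter of larger absolute value, which is at least 2 and so not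
   flipped. *)
congr nat_of_bool; rewrite /flip_one.
by case: ifP => ha; case: ifP => hb; apply/idP/idP; lia.
Qed.

(** Exactly one letter has absolute value 1, so flipping it exchanges even and odd words, and des_D
    is preserved. *)
Lemma sum_even_swords n (G : nat -> {poly rat}) : (1 < n)%N ->
  \sum_(w <- swords n) G (desDw w)
  = 2%:R * \sum_(w <- swords n | ~~ odd (negs w)) G (desDw w).
Proof.
move=> n1; rewrite (bigID (fun w => ~~ odd (negs w))) /= mulr2n mulrDl !mul1r.
congr (_ + _); rewrite big_mkcond [RHS]big_mkcond /=.
have fK : involutive (map flip_one) by exact: mapK flip_oneK.
have fa w : absw (map flip_one w) = absw w.
  by rewrite /absw -map_comp; apply: eq_map => x; apply: absz_flip_one.
rewrite -[RHS](sum_swords_sym _ _ fK fa); apply: eq_big_seq => w wn.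
rewrite odd_negs_flip_one (desDw_flip_one n1 wn).
move: wn; rewrite mem_swords => wn.
rewrite count_uniq_mem ?(perm_uniq wn) ?iota_uniq // (perm_mem wn) mem_iota.
have -> : (1 <= 1 < 1 + n)%N by lia.
by rewrite addbT negbK.
Qed.

(** * Eulerian numbers, the Bernoulli term and the conclusion *)

Lemma negs_word n (p : {perm letter n}) :
  #|[set i : 'I_n | sp_at p i.+1 < 0]| = negs (word p).
Proof.
rewrite /negs count_map cardsE cardE size_filter enumT.
by apply: eq_count => i; rewrite /= unfold_in /= sp_atE.
Qed.

Lemma sum_eulerianD n (G : nat -> {poly rat}) : (0 < n)%N ->
  \sum_(0 <= k < n.+1) (eulerianD n k)%:R *: G k
  = \sum_(w <- swords n | ~~ odd (negs w)) G (desDw w).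
Proof.
move=> n0; rewrite [RHS]big_mkcond -sum_signed_perms -big_mkcondr /=.
rewrite (eq_bigl (mem (even_signed_perms n))) => [|p]; last first.
  by rewrite [RHS]inE negs_word.
under [RHS]eq_bigr do rewrite -desD_word //.
rewrite big_mkord.
(* [DesD p] is a subset of ['I_n], so des_D is at most n and [inord] does not alter it. *)
rewrite [RHS](partition_big (fun p => inord (desD p) : 'I_n.+1) predT) //=.
apply: eq_bigr => k _; rewrite scaler_nat -sumr_const.
have desb p : (@desD n p < n.+1)%N by rewrite ltnS -[X in (_ <= X)%N]card_ord max_card.
have desn p : inord (desD p) = k :> 'I_n.+1 <-> @desD n p = k.
  by split=> [<-|->]; rewrite ?inord_val // inordK.
apply: eq_big => [p|p]; first by rewrite inE; congr (_ && _); apply/eqP/eqP => /desn.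
by rewrite inE => /andP[_ /eqP ->].
Qed.

Lemma sum_binomial_behead n : (1 < n)%N ->
  \sum_(w <- swords n) binomial_poly (n%:R + 'X - (des (behead w)).+1%:R) n
  = 2%:R ^+ n *: (bernoulli_poly n \Po ('X + 1) - (bernoulli_number n)%:P).
Proof.
move=> n1; set P := LHS; set Q := (X in _ = _ *: X).
have dB := bernoulli_poly_diff (ltnW n1).
have dQ : Q \Po ('X + 1) = Q + n%:R *: ('X + 1) ^+ n.-1.
  rewrite -[LHS](subrK Q) [RHS]addrC; congr (_ + _).
  rewrite /Q rmorphB /= comp_polyC opprB addrA subrK -rmorphB /= dB linearZ /=.
  by rewrite rmorphXn /= comp_polyX.
have dP : P \Po ('X + 1) = P + 2%:R ^+ n *: (n%:R *: ('X + 1) ^+ n.-1).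
  rewrite -[LHS](subrK P) [RHS]addrC; congr (_ + _).
  rewrite /P rmorph_sum -sumrB /=.
  case: n n1 {P Q dB dQ} => // n _.
  (* The increment is the sum of [sum_behead_wordA] at x + 1; Pascal's rule matches it with P(x + 1)
     - P(x) word by word. *)
  have -> : 2%:R ^+ n.+1 *: (n.+1%:R *: ('X + 1) ^+ n) =
      (2%:R * n.+1%:R * (2%:R * 'X) ^+ n) \Po ('X + 1) :> {poly rat}.
    rewrite !rmorphM rmorphXn rmorphM /= comp_polyX !rmorph_nat.
    by rewrite -!mul_polyC rmorphXn /= !polyC_natr exprMn exprS; ring.
  rewrite -sum_behead_wordA rmorph_sum /=; apply: eq_big_seq => w wn.
  rewrite /wordA !binomial_poly_comp size_behead (@size_swords n.+1 w wn) /=.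
  rewrite !rmorphB !rmorphD /= comp_polyX !rmorph_nat rmorph1; set r := des _.
  have -> : n.+1%:R + ('X + 1) - r.+1%:R = (n.+1%:R + 'X - r.+1%:R) + 1 :> {poly rat}.
    by ring.
  rewrite binomial_poly_pascal addrAC subrr add0r; congr binomial_poly.
  by rewrite -!natr1; ring.
apply/eqP; rewrite -subr_eq0; apply/eqP/poly_periodic_eq0.
  by rewrite comp_polyB comp_polyZ dP dQ scalerDr opprD addrACA subrr addr0.
(* The difference equation at 0 gives B_n(1) = B_n(0), as n - 1 > 0. *)
have Q0 : Q.[0] = 0.
  rewrite /Q hornerD hornerN hornerC /bernoulli_number -hornerN -hornerD dB.
  by rewrite hornerZ hornerXn expr0n; case: (n) n1 => [|[]] // k _; rewrite mulr0.
rewrite hornerD hornerN hornerZ Q0 mulr0 subr0 /P horner_sum big_seq big1 // => w wn.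
have := size_swords wn; case: w wn => [|x [|y w]] wn sw; try by rewrite -sw in n1.
have rn : (des (behead [:: x, y & w]) <= size w)%N by exact: desc_le_size.
set r := des _ in rn *.
(* At x = 0 the upper argument is the natural number n - (r + 1) < n, so the binomial vanishes. *)
apply: (@horner_binomial_nat _ (n - r.+1)).
  by rewrite -sw /=; lia.
rewrite !hornerD hornerN hornerX -!polyC_natr !hornerC addr0 natrB //.
by rewrite -sw ltnS (leq_trans rn).
Qed.

Theorem proposition4p1 (n : nat) (n_ge2 : (2 <= n)%N) :
  (1 + 2%:R *: 'X) ^+ n
    - 2%:R ^+ (n - 1) *:
        (bernoulli_poly n \Po ('X + 1) - (bernoulli_number n)%:P)
  = \sum_(0 <= k < n.+1)
      (eulerianD n k)%:R *: binomial_poly (n%:R + 'X - k%:R) n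
    :> {poly rat}.
Proof.
have n_gt0 := ltnW n_ge2; pose G d := binomial_poly (n%:R + 'X - d%:R) n.
rewrite (sum_eulerianD G n_gt0).
have := sum_desD_desB G n_ge2; rewrite big_split /= (sum_even_swords G n_ge2).
rewrite (sum_binomial_behead n_ge2).
rewrite (eq_big_seq wordB) => [|w /size_swords wn]; last by rewrite /wordB wn.
(* Now all three terms carry a factor 2, which cancels. *)
have -> : 2%:R ^+ n = 2%:R * 2%:R ^+ (n - 1) :> rat by rewrite -exprS subn1 prednK.
have sc2 (p : {poly rat}) : 2%:R *: p = 2%:R * p by rewrite scaler_nat mulr_natl.
rewrite sum_wordB -scalerA !sc2 -mulrDr.
by move/(mulfI (polyQ_nat_neq0 1)) <-; rewrite addrK.
Qed.
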